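(* The quaternion group $Q_8 = \{\pm 1, \pm i, \pm j, \pm k\}$ of order $8$ does not have a basis.
   Context: Basis: Let $G$ be a finite group with identity $e$, and write $|b|$ for the order of an element $b$. A tuple $(b_1,\ldots,b_n) \in (G\setminus\{e\})^n$ is a basis for $G$ if for every $g \in G$ there is a unique tuple $(a_1,\ldots,a_n)$ with $a_i \in \{0,\ldots,|b_i|-1\}$ for all $i$ such that $g = b_1^{a_1}\cdots b_n^{a_n}$ (the product taken in this order). *)

(* Defs.v *)
From HB Require Import structures.
#[warnings="-notation-overridden"]
From mathcomp Require Import all_boot all_fingroup all_solvable.

Set Implicit Arguments.
Unset Strict Implicit.
Unset Printing Implicit Defensive.

Local Open Scope group_scope.

Definition is_basis (gT : finGroupType) (G : {group gT}) (n : nat)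
    (b : n.-tuple gT) : Prop :=
  (forall i : 'I_n, tnth b i \in G^#) /\
  (forall g : gT, g \in G ->
     exists! a : n.-tuple nat,
       (forall i : 'I_n, tnth a i < #[tnth b i]) /\
       g = \prod_(i < n) tnth b i ^+ tnth a i).

Definition has_basis (gT : finGroupType) (G : {group gT}) : Prop :=
  exists (n : nat) (b : n.-tuple gT), is_basis G b.

(* 'Q_8 is constructed as a quotient of a semidirect product. This lemma
   recovers the usual description {1, -1, i, -i, j, -j, k, -k}, with z playing
   the role of -1; the eight elements listed are distinct since #|'Q_8| = 8. *)
Lemma quaternion8E :
  #|'Q_8| = 8 /\
  exists z i j k : 'Q_8,
    [/\ i ^+ 2 = z, j ^+ 2 = z, k ^+ 2 = z, i * j * k = z &
        'Q_8 = [set 1; z; i; z * i; j; z * j; k; z * k]].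
Proof.
have oQ : #|'Q_8| = 8 by rewrite (@card_quaternion 3).
split=> //.
have isoQ : 'Q_8 \isog 'Q_(2 ^ 3) by exact: isog_refl.
have [[x y] genQ [oy y2 xy]] := generators_quaternion (isT : 2 < 3) isoQ.
have [_ _ _ defQ _] := extremal_generators_facts (isT : prime 2) genQ.
have [_ _ ox _] := genQ.
move: y2 xy ox => /= y2 xy ox.
have x4 : x ^+ 4 = 1 by rewrite -[X in _ ^+ X]ox expg_order.
have xyx : x * y * x = y.
  have : x ^ y * x = 1 by rewrite xy mulVg.
  by rewrite conjgE -!mulgA => /(canRL (mulKVg _)); rewrite mulg1.
have xyxy : x * y * (x * y) = x ^+ 2 by rewrite mulgA xyx -y2.
exists (x ^+ 2), x, y, (x * y); split=> //.
apply/setP=> g; rewrite in_setT; apply/esym.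
have : g \in <[x]> * <[y]> by rewrite defQ inE.
case/mulsgP=> _ _ /cycleP[a ->] /cycleP[b ->] ->.
rewrite -(odd_double_half b) -mul2n addnC expgD expgM y2 -expgM mulgA -expgD.
set c := (a + _)%N; rewrite -(expg_mod c x4).
have: c %% 4 < 4 by rewrite ltn_mod.
case: (odd b); rewrite ?expg0 ?expg1 ?mulg1.
all: case: (c %% 4) => [|[|[|[|//]]]] _.
all: by rewrite !inE ?expg0 ?mul1g ?expg1 ?mulgA -?expgSr eqxx ?orbT.
Qed.

(* Main.v *)
(* Every nontrivial element of a 2-group has an involution among its powers.
   If the group has a unique involution [z], then [z] is a power of each basis
   element, so two distinct basis elements would yield two distinct
   representations of [z]. A basis thus has at most one element, which forces
   the group to be cyclic, whereas 'Q_8 is not even abelian. *)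
Require Import Defs.
From HB Require Import structures.
From mathcomp Require Import all_boot all_fingroup all_solvable.

Set Implicit Arguments.
Unset Strict Implicit.
Unset Printing Implicit Defensive.

Local Open Scope group_scope.

(** The order of [x] is [2 ^ k.+1], so halving it is exact. The strict bound makes the half order an
    admissible exponent in a basis representation. *)
Lemma order_half_expg (gT : finGroupType) (G : {group gT}) (x : gT) :
  2.-group G -> x \in G^# -> #[x ^+ (#[x] %/ 2)] = 2 /\ #[x] %/ 2 < #[x].
Proof.
move=> pG /setD1P[x1 Gx].
have [k ok] := p_natP (mem_p_elt pG Gx).
case: k ok => [|k] ok; first by move/eqP: ok; rewrite order_eq1 (negPf x1).
have dv2 : 2 %| #[x] by rewrite ok expnS dvdn_mulr.
split; last by rewrite ltn_Pdiv.
by rewrite orderXdiv ?dvdn_div // divnA // mulKn.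
Qed.

(** Puts a power of one basis element into the product form required by [is_basis]. *)
Lemma prod_expg_single (gT : finGroupType) (n : nat) (b : n.-tuple gT)
    (i : 'I_n) (m : nat) :
  \prod_(j < n) tnth b j ^+ tnth [tuple (if k == i then m else 0) | k < n] j
    = tnth b i ^+ m.
Proof.
have Ei j : tnth [tuple (if k == i then m else 0) | k < n] j
    = if j == i then m else 0 by rewrite tnth_mktuple.
under eq_bigr => j _ do rewrite Ei.
transitivity (\prod_(j < n | j == i) tnth b j ^+ m); last by rewrite big_pred1_eq.
by rewrite [RHS]big_mkcond; apply: eq_bigr => j _; case: eqP.
Qed.

Lemma unique_involution_basis_cyclic (gT : finGroupType) (G : {group gT})
    (z : gT) :
  2.-group G -> (forall u, u \in G -> #[u] = 2 -> u = z) ->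
  has_basis G -> cyclic G.
Proof.
move=> pG z_uniq [n [b [Gb basis_b]]].
have zE i : tnth b i ^+ (#[tnth b i] %/ 2) = z.
  have /setD1P[_ Gbi] := Gb i.
  by apply: z_uniq; [exact: groupX | case: (order_half_expg pG (Gb i))].
(* Length 0 forces the trivial group, length 1 a group generated by the only entry; longer tuples
   lead to a contradiction. *)
case: n => [|[|n]] in b Gb basis_b zE *.
- suff -> : G :=: 1 by exact: cyclic1.
  apply/trivgP/subsetP=> g /basis_b[a [[_ ->] _]].
  by rewrite big_ord0 inE.
- apply/cyclicP; exists (tnth b ord0); apply/eqP.
  have /setD1P[_ Gb0] := Gb ord0.
  rewrite eqEsubset cycle_subG Gb0 andbT; apply/subsetP=> g /basis_b[a [[_ ->] _]].
  by rewrite big_ord1 mem_cycle.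
pose a i := [tuple (if k == i then #[tnth b i] %/ 2 else 0) | k < n.+2].
have repr_z i : (forall j, tnth (a i) j < #[tnth b j]) /\
    z = \prod_(j < n.+2) tnth b j ^+ tnth (a i) j.
  split=> [j|]; last by rewrite prod_expg_single zE.
  rewrite tnth_mktuple; case: eqP => [->|_]; last exact: order_gt0.
  by case: (order_half_expg pG (Gb i)).
have Gz : z \in G by have /setD1P[_ Gb0] := Gb ord0; rewrite -(zE ord0) groupX.
have [c [_ c_uniq]] := basis_b z Gz.
(* At index [ord0] the first tuple holds a half order and the second holds 0, since [ord0] and
   [ord_max] differ in length [n.+2]. *)
have /(congr1 (fun t => tnth t ord0)) : a ord0 = a ord_max.
  by rewrite -(c_uniq _ (repr_z ord0)) -(c_uniq _ (repr_z ord_max)).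
rewrite !tnth_mktuple eqxx /= => half0.
(* A zero half order would give the identity order 2. *)
have [] := order_half_expg pG (Gb ord0).
by rewrite half0 expg0 order1.
Qed.

Theorem proposition1p1 : ~ @has_basis ('Q_8)%type ('Q_8)%G.
Proof.
have oQ : #|'Q_8| = 8 by rewrite (@card_quaternion 3).
have pQ : 2.-group 'Q_8 by rewrite /pgroup oQ.
have isoQ : 'Q_8 \isog 'Q_(2 ^ 3) by exact: isog_refl.
have [[x y] genQ _] := generators_quaternion (isT : 2 < 3) isoQ.
have [_ _ [_ oZ z_uniq _ _] _ _] := quaternion_structure (isT : 2 < 3) genQ isoQ.
(* Commutativity would make the center, of order 2, equal to the whole group of order 8. *)
move=> /(unique_involution_basis_cyclic pQ z_uniq)/cyclic_abelian/center_idP ZQ.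
by move: oZ; rewrite ZQ oQ.
Qed.
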